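(* Let $\mathbb{k}$ be a field, let $n\ge 2$ be an integer, let $A$ be an associative unital $\mathbb{k}$-algebra, let $\sigma$ be a $\mathbb{k}$-algebra automorphism of $A$ and let $\delta:A\to A$ be a left $\sigma$-derivation. Let $A[x;\sigma,\delta]$ be the corresponding Ore extension and let $\tau:\mathbb{k}[x]\otimes A\to A\otimes \mathbb{k}[x]$ be the twisting map associated with it, i.e. the twisting map determined by $\tau(x\otimes a)=\sigma(a)\otimes x+\delta(a)\otimes 1$ for all $a\in A$. If $$s_{(i,j)}(\sigma,\delta)=0\quad\text{as maps } A\to A$$ for all $i\in\{0,1,\dots,n-1\}$ and $j\in\{1,2,\dots,n\}$ with $i+j=n$, then $\tau$ induces a well-defined multiplication on $A[\overline{x};\sigma,\delta]=A\otimes_\tau \mathbb{k}[x]/(x^n)$; that is, $\tau$ descends to a well-defined twisting map $\mathbb{k}[x]/(x^n)\otimes A\to A\otimes \mathbb{k}[x]/(x^n)$, which defines the multiplication of $A\otimes_\tau \mathbb{k}[x]/(x^n)$.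
   Context: All tensor products are over $\mathbb{k}$. For $\mathbb{k}$-algebras $A,B$ with multiplication maps $m_A,m_B$, a twisting map is a bijective $\mathbb{k}$-linear map $\tau:B\otimes A\to A\otimes B$ with $\tau(1_B\otimes a)=a\otimes 1_B$, $\tau(b\otimes 1_A)=1_A\otimes b$ for all $a\in A,b\in B$, and $$\tau(m_B\otimes m_A)=(m_A\otimes m_B)(1\otimes\tau\otimes 1)(\tau\otimes\tau)(1\otimes\tau\otimes 1)$$ as maps $B\otimes B\otimes A\otimes A\to A\otimes B$. The twisted tensor product algebra $A\otimes_\tau B$ is the vector space $A\otimes B$ with (associative) multiplication $(m_A\otimes m_B)(1\otimes\tau\otimes 1)$. A left $\sigma$-derivation is a $\mathbb{k}$-linear map $\delta:A\to A$ with $\delta(aa')=\delta(a)a'+\sigma(a)\delta(a')$ for all $a,a'\in A$. The Ore extension $A[x;\sigma,\delta]$ is the associative algebra with underlying vector space $A[x]$ and multiplication determined by that of $A$ and $\mathbb{k}[x]$ and the relation $xa=\sigma(a)x+\delta(a)$; it is isomorphic to $A\otimes_\tau\mathbb{k}[x]$, where $\tau:\mathbb{k}[x]\otimes A\to A\otimes\mathbb{k}[x]$ is the twisting map determined by $\tau(x\otimes a)=\sigma(a)\otimes x+\delta(a)\otimes 1$ for all $a\in A$. A truncated Ore extension $A[\overline{x};\sigma,\delta]$ is an associative algebra with underlying vector space $A[x]/(x^n)$ and multiplication determined by that of $A$ and of $\mathbb{k}[x]/(x^n)$ and the relation $\overline{x}a=\sigma(a)\overline{x}+\delta(a)$, where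 $\overline{x}=x+(x^n)$. For maps $f,g$ from a set to itself (linear), $s_{(i,j)}(f,g)$ denotes the sum of all distinct compositions (words) using exactly $i$ copies of $f$ and $j$ copies of $g$; e.g. $s_{(1,2)}(\sigma,\delta)=\sigma\delta^2+\delta\sigma\delta+\delta^2\sigma$. *)

(* Defs.v *)
From HB Require Import structures.
From mathcomp Require Import all_boot all_order all_algebra.
From mathcomp Require Import generic_quotient.
From mathcomp Require Import boolp.

Set Implicit Arguments.
Unset Strict Implicit.
Unset Printing Implicit Defensive.

Import GRing.Theory.

Local Open Scope ring_scope.
Local Open Scope quotient_scope.

Notation is_bilinear f := (bilinear_for *:%R *:%R f).

(* Associative unital k-algebras, the zero algebra included: MathComp's algType *)
(* requires 1 != 0.                                                             *)
HB.mixin Record Lmodule_isUAlgebra (k : fieldType) A of GRing.Lmodule k A := {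
  alg1 : A;
  algM : A -> A -> A;
  algMA : associative algM;
  alg1M : left_id alg1 algM;
  algM1 : right_id alg1 algM;
  algM_bilinear : is_bilinear algM
}.

#[short(type="uAlgType")]
HB.structure Definition UAlgebra (k : fieldType) :=
  { A of GRing.Lmodule k A & Lmodule_isUAlgebra k A }.

Arguments alg1 {k s}.
Notation "a ∙ b" := (algM a b) (at level 40, left associativity) : ring_scope.

Fact mul_bilinear (k : fieldType) (A : algType k) :
  is_bilinear (fun a b : A => a * b).
Proof.
split=> [b|a] c x y /=; first by rewrite mulrDl scalerAl.
by rewrite mulrDr scalerAr.
Qed.

HB.instance Definition _ (k : fieldType) :=
  Lmodule_isUAlgebra.Build k {poly k}
    (@mulrA {poly k}) (@mul1r {poly k}) (@mulr1 {poly k})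
    (mul_bilinear {poly k}).

HB.instance Definition _ (k : fieldType) (h : {poly k}) :=
  Lmodule_isUAlgebra.Build k {poly %/ h}
    (@mulrA {poly %/ h}) (@mul1r {poly %/ h}) (@mulr1 {poly %/ h})
    (mul_bilinear {poly %/ h}).

Section Tensor.
Variables (k : fieldType) (V W : lmodType k).

(* V (x) W is the set of formal sums of pairs (v, w), identified when no        *)
(* bilinear map distinguishes them. The scalars are absorbed in the first       *)
(* component, so lists of pairs suffice. The universal property is              *)
(* [tensor_bilinear], [tensor_liftE] and [tensor_ext] below.                    *)
Definition pair_sum (U : lmodType k) (f : V -> W -> U) (s : seq (V * W)) : U :=
  \sum_(p <- s) f p.1 p.2.

Definition tensor_rel : rel (seq (V * W)) := fun s t =>
  `[< forall (U : lmodType k) (f : V -> W -> U),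
        is_bilinear f -> pair_sum f s = pair_sum f t >].

Fact tensor_rel_refl : reflexive tensor_rel.
Proof. by move=> s; apply/asboolP. Qed.

Fact tensor_rel_sym : symmetric tensor_rel.
Proof. by move=> s t; apply/asboolP/asboolP => h U f bf; rewrite h. Qed.

Fact tensor_rel_trans : transitive tensor_rel.
Proof.
by move=> t s u /asboolP h1 /asboolP h2; apply/asboolP => U f bf; rewrite h1 ?h2.
Qed.

Canonical tensor_equiv :=
  EquivRel tensor_rel tensor_rel_refl tensor_rel_sym tensor_rel_trans.

Definition tensor_type := {eq_quot tensor_equiv}.

HB.instance Definition _ := Choice.on tensor_type.
HB.instance Definition _ := Quotient.on tensor_type.

Definition tclass (s : seq (V * W)) : tensor_type := \pi_tensor_type s.

Lemma tclassP (s t : seq (V * W)) :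
  (forall (U : lmodType k) (f : V -> W -> U),
     is_bilinear f -> pair_sum f s = pair_sum f t) <-> tclass s = tclass t.
Proof.
split=> [h|h]; first by apply/eqmodP/asboolP.
by apply/asboolP; apply/(@eqmodP _ tensor_equiv s t).
Qed.

Lemma tclassK (x : tensor_type) : tclass (repr x) = x.
Proof. exact: reprK. Qed.

Lemma pair_sum_repr (U : lmodType k) (f : V -> W -> U) s :
  is_bilinear f -> pair_sum f (repr (tclass s)) = pair_sum f s.
Proof. by move: (tclassK (tclass s)) => /tclassP; apply. Qed.

Definition topp (s : seq (V * W)) := [seq (- p.1, p.2) | p <- s].
Definition tscale (c : k) (s : seq (V * W)) := [seq (c *: p.1, p.2) | p <- s].

Lemma pair_sum_cat (U : lmodType k) (f : V -> W -> U) s t :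
  pair_sum f (s ++ t) = pair_sum f s + pair_sum f t.
Proof. exact: big_cat. Qed.

Lemma pair_sum_scale (U : lmodType k) (f : V -> W -> U) c s :
  is_bilinear f -> pair_sum f (tscale c s) = c *: pair_sum f s.
Proof.
move=> bf; rewrite /pair_sum big_map scaler_sumr.
by apply: eq_bigr => p _; rewrite (scalable_linear (bf.1 p.2)).
Qed.

Lemma pair_sum_opp (U : lmodType k) (f : V -> W -> U) s :
  is_bilinear f -> pair_sum f (topp s) = - pair_sum f s.
Proof.
move=> bf; rewrite -scaleN1r -pair_sum_scale // /topp /tscale.
by congr pair_sum; apply: eq_map => p; rewrite scaleN1r.
Qed.

Definition tensor_zero : tensor_type := tclass [::].
Definition tensor_add (x y : tensor_type) : tensor_type :=
  tclass (repr x ++ repr y).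
Definition tensor_opp (x : tensor_type) : tensor_type := tclass (topp (repr x)).
Definition tensor_scale (c : k) (x : tensor_type) : tensor_type :=
  tclass (tscale c (repr x)).

Let pE := (pair_sum_cat, pair_sum_repr, pair_sum_scale, pair_sum_opp).

Fact tensor_addA : associative tensor_add.
Proof. by move=> x y z; apply/tclassP => U f bf; rewrite !pE // addrA. Qed.

Fact tensor_addC : commutative tensor_add.
Proof. by move=> x y; apply/tclassP => U f bf; rewrite !pE // addrC. Qed.

Fact tensor_add0 : left_id tensor_zero tensor_add.
Proof.
move=> x; rewrite -[RHS]tclassK; apply/tclassP => U f bf.
by rewrite !pE // /pair_sum big_nil add0r.
Qed.

Fact tensor_addN : left_inverse tensor_zero tensor_opp tensor_add.
Proof.
by move=> x; apply/tclassP => U f bf; rewrite !pE // addNr /pair_sum big_nil.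
Qed.

HB.instance Definition _ := GRing.isZmodule.Build tensor_type
  tensor_addA tensor_addC tensor_add0 tensor_addN.

Fact tensor_scaleA a b x :
  tensor_scale a (tensor_scale b x) = tensor_scale (a * b) x.
Proof. by apply/tclassP => U f bf; rewrite !pE // scalerA. Qed.

Fact tensor_scale1 : left_id 1 tensor_scale.
Proof.
move=> x; rewrite -[RHS]tclassK; apply/tclassP => U f bf.
by rewrite !pE // scale1r.
Qed.

Fact tensor_scaleDr : right_distributive tensor_scale +%R.
Proof. by move=> a x y; apply/tclassP => U f bf; rewrite !pE // scalerDr. Qed.

Fact tensor_scaleDl x : {morph tensor_scale^~ x : a b / a + b}.
Proof. by move=> a b; apply/tclassP => U f bf; rewrite !pE // scalerDl. Qed.

HB.instance Definition _ := GRing.Zmodule_isLmodule.Build k tensor_type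
  tensor_scaleA tensor_scale1 tensor_scaleDr tensor_scaleDl.

Definition tensor : lmodType k := tensor_type.

Definition tens (v : V) (w : W) : tensor := tclass [:: (v, w)].

Lemma tensor_bilinear : is_bilinear tens.
Proof.
split=> [w|v] c x y; apply/tclassP => U f bf;
  rewrite !pE // /pair_sum !big_seq1 /=; first exact: bf.1.
exact: bf.2.
Qed.

Lemma tclassE s : (tclass s : tensor) = \sum_(p <- s) tens p.1 p.2.
Proof.
elim: s => [|p s IHs]; first by rewrite big_nil.
rewrite big_cons -IHs; apply/tclassP => U f bf.
by rewrite !pE // -pair_sum_cat; case: p.
Qed.

Section Lift.
Variables (U : lmodType k) (f : V -> W -> U).
Hypothesis bf : is_bilinear f.

Definition tensor_lift (_ : is_bilinear f) (x : tensor) : U :=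
  pair_sum f (repr x).

Fact tensor_lift_linear : linear (tensor_lift bf).
Proof. by move=> c x y; rewrite /tensor_lift !pE. Qed.

HB.instance Definition _ :=
  GRing.isLinear.Build k tensor U *:%R (tensor_lift bf) tensor_lift_linear.

Lemma tensor_liftE v w : tensor_lift bf (tens v w) = f v w.
Proof. by rewrite /tensor_lift !pE // /pair_sum big_seq1. Qed.

End Lift.

Lemma tensor_ext (U : lmodType k) (f g : {linear tensor -> U}) :
  (forall v w, f (tens v w) = g (tens v w)) -> f =1 g.
Proof.
move=> fg x; rewrite -[x]tclassK tclassE !linear_sum.
by apply: eq_bigr => p _.
Qed.

End Tensor.

Arguments tensor {k} V W : simpl never.
Arguments tens {k V W} v w.

Declare Scope tensor_scope.
Delimit Scope tensor_scope with T.
Notation "V ⊗ W" := (tensor V W)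
  (at level 40, left associativity) : tensor_scope.
Notation "v ⊗t w" := (tens v w)
  (at level 40, left associativity) : ring_scope.
Open Scope tensor_scope.

Section TensorMaps.
Variable k : fieldType.

Section Map.
Variables (V V' W W' : lmodType k).
Variables (f : {linear V -> V'}) (g : {linear W -> W'}).

Fact tmap_bilinear : is_bilinear (fun v w => f v ⊗t g w).
Proof.
split=> [w|v] c x y; rewrite linearP; first exact: (tensor_bilinear _ _).1.
exact: (tensor_bilinear _ _).2.
Qed.

Definition tmap : V ⊗ W -> V' ⊗ W' := tensor_lift tmap_bilinear.
HB.instance Definition _ := GRing.Linear.on tmap.

Lemma tmapE v w : tmap (v ⊗t w) = f v ⊗t g w.
Proof. exact: tensor_liftE. Qed.

End Map.

Section Assoc.
Variables (U V W : lmodType k).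

Fact tassoc_bilinear1 (w : W) :
  is_bilinear (fun (u : U) (v : V) => u ⊗t (v ⊗t w)).
Proof.
split=> [v|u] c x y; first exact: (tensor_bilinear _ _).1.
by rewrite (tensor_bilinear _ _).1 (tensor_bilinear _ _).2.
Qed.

Fact tassoc_bilinear :
  is_bilinear (fun (x : U ⊗ V) (w : W) => tensor_lift (tassoc_bilinear1 w) x).
Proof.
split=> [w|x] c y z; first exact: linearP.
pose h w : {linear U ⊗ V -> U ⊗ (V ⊗ W)} := tensor_lift (tassoc_bilinear1 w).
suff: h (c *: y + z) =1 (c \*: h y \+ h z) by apply.
by apply: tensor_ext => u v /=; rewrite !tensor_liftE !(tensor_bilinear _ _).2.
Qed.

Definition tassoc : (U ⊗ V) ⊗ W -> U ⊗ (V ⊗ W) :=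
  tensor_lift tassoc_bilinear.
HB.instance Definition _ := GRing.Linear.on tassoc.

Lemma tassocE u v w : tassoc ((u ⊗t v) ⊗t w) = u ⊗t (v ⊗t w).
Proof. by rewrite /tassoc /= !tensor_liftE. Qed.

Fact tassoc_inv_bilinear1 (u : U) :
  is_bilinear (fun (v : V) (w : W) => u ⊗t v ⊗t w).
Proof.
split=> [w|v] c x y; last exact: (tensor_bilinear _ _).2.
by rewrite (tensor_bilinear _ _).2 (tensor_bilinear _ _).1.
Qed.

Fact tassoc_inv_bilinear :
  is_bilinear (fun (u : U) (x : V ⊗ W) => tensor_lift (tassoc_inv_bilinear1 u) x).
Proof.
split=> [x|u] c y z; last exact: linearP.
pose h u : {linear V ⊗ W -> (U ⊗ V) ⊗ W} :=
  tensor_lift (tassoc_inv_bilinear1 u).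
suff: h (c *: y + z) =1 (c \*: h y \+ h z) by apply.
by apply: tensor_ext => v w /=; rewrite !tensor_liftE !(tensor_bilinear _ _).1.
Qed.

Definition tassoc_inv : U ⊗ (V ⊗ W) -> (U ⊗ V) ⊗ W :=
  tensor_lift tassoc_inv_bilinear.
HB.instance Definition _ := GRing.Linear.on tassoc_inv.

Lemma tassoc_invE u v w : tassoc_inv (u ⊗t (v ⊗t w)) = (u ⊗t v) ⊗t w.
Proof. by rewrite /tassoc_inv /= !tensor_liftE. Qed.

End Assoc.

Arguments tassoc : clear implicits.
Arguments tassoc_inv : clear implicits.

Definition tid (V : lmodType k) : {linear V -> V} := idfun.

(* 1 (x) f (x) 1, with the rebracketing that the usual notation suppresses.     *)
Definition tmid (P X Y Z W Q : lmodType k) (f : {linear X ⊗ Y -> Z ⊗ W}) :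
    (P ⊗ X) ⊗ (Y ⊗ Q) -> (P ⊗ Z) ⊗ (W ⊗ Q) :=
  tassoc_inv P Z (W ⊗ Q)
  \o tmap (tid P) (tassoc Z W Q \o tmap f (tid Q) \o tassoc_inv X Y Q)
  \o tassoc P X (Y ⊗ Q).
HB.instance Definition _ P X Y Z W Q f := GRing.Linear.on (@tmid P X Y Z W Q f).

End TensorMaps.

Arguments tmap {k V V' W W'} f g _ : simpl never.
Arguments tassoc {k} U V W _ : simpl never.
Arguments tassoc_inv {k} U V W _ : simpl never.
Arguments tid {k} V.
Arguments tmid {k} P {X Y Z W} Q f _ : simpl never.

Lemma tmidE (k : fieldType) (P X Y Z W Q : lmodType k)
    (f : {linear X ⊗ Y -> Z ⊗ W}) p x y q z w :
  f (x ⊗t y) = z ⊗t w ->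
  tmid P Q f ((p ⊗t x) ⊗t (y ⊗t q)) = (p ⊗t z) ⊗t (w ⊗t q).
Proof.
move=> fxy; rewrite /tmid /= tassocE tmapE /= tassoc_invE tmapE fxy.
by rewrite tassocE tassoc_invE.
Qed.

Section Twisting.
Variable k : fieldType.

Definition tmul (A : uAlgType k) : A ⊗ A -> A :=
  tensor_lift (@algM_bilinear k A).

Arguments tmul : clear implicits.

HB.instance Definition _ (A : uAlgType k) := GRing.Linear.on (tmul A).

Lemma tmulE (A : uAlgType k) (a b : A) : tmul A (a ⊗t b) = a ∙ b.
Proof. exact: tensor_liftE. Qed.

Section TwistingMap.
Variables (A B : uAlgType k) (tau : {linear B ⊗ A -> A ⊗ B}).

Definition twisting_map : Prop :=
  [/\ bijective tau,
      forall a : A, tau (alg1 ⊗t a) = a ⊗t alg1,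
      forall b : B, tau (b ⊗t alg1) = alg1 ⊗t b
    & tau \o tmap (tmul B) (tmul A)
      =1 tmap (tmul A) (tmul B) \o tmid A B tau \o tmap tau tau
           \o tmid B A tau].

Definition twisted_mul : (A ⊗ B) ⊗ (A ⊗ B) -> A ⊗ B :=
  tmap (tmul A) (tmul B) \o tmid A B tau.
HB.instance Definition _ := GRing.Linear.on twisted_mul.

End TwistingMap.

Section Ore.
Variables (A : uAlgType k) (sigma delta : {linear A -> A}).

Definition algebra_automorphism : Prop :=
  [/\ sigma alg1 = alg1, {morph sigma : a b / a ∙ b} & bijective sigma].

Definition left_derivation : Prop :=
  forall a a' : A, delta (a ∙ a') = delta a ∙ a' + sigma a ∙ delta a'.

(* For R = k[x] (resp. k[x]/(x^n)) with its generator x: mul makes the vector   *)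
(* space A (x) R into the Ore extension A[x; sigma, delta] (resp. a truncated   *)
(* Ore extension).                                                              *)
Definition ore_multiplication (R : uAlgType k) (x : R)
    (mul : {linear (A ⊗ R) ⊗ (A ⊗ R) -> A ⊗ R}) : Prop :=
  [/\ associative (fun u v => mul (u ⊗t v)),
      left_id (alg1 ⊗t alg1) (fun u v => mul (u ⊗t v))
        /\ right_id (alg1 ⊗t alg1) (fun u v => mul (u ⊗t v)),
      (forall a a' : A, mul ((a ⊗t alg1) ⊗t (a' ⊗t alg1)) = (a ∙ a') ⊗t alg1)
        /\ (forall p q : R, mul ((alg1 ⊗t p) ⊗t (alg1 ⊗t q)) = alg1 ⊗t (p ∙ q)),
      forall (a : A) (p : R), mul ((a ⊗t alg1) ⊗t (alg1 ⊗t p)) = a ⊗t p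
    & forall a : A,
        mul ((alg1 ⊗t x) ⊗t (a ⊗t alg1)) = sigma a ⊗t x + delta a ⊗t alg1].

Definition ore_twisting_map (tau : {linear {poly k} ⊗ A -> A ⊗ {poly k}}) :
    Prop :=
  twisting_map tau
  /\ forall a : A, tau ('X ⊗t a) = sigma a ⊗t 'X + delta a ⊗t alg1.

End Ore.

End Twisting.

Arguments tmul {k} A _ : simpl never.

(* A word in f and g, encoded by a list of booleans: true stands for f, false   *)
(* for g.                                                                       *)
Definition word_comp (T : Type) (f g : T -> T) (w : seq bool) : T -> T :=
  foldr (fun b h => (if b then f else g) \o h) id w.

(* s_(i,j)(f, g), evaluated at a. *)
Definition s_words (V : zmodType) (i j : nat) (f g : V -> V) (a : V) : V :=
  \sum_(w : (i + j).-tuple bool | count_mem true w == i) word_comp f g w a.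

(* Main.v *)
(* With u * v the multiplication twisted by tau, the hexagon identity gives
   tau (pq ⊗ a) = (1 ⊗ p) * tau (q ⊗ a). Iterating this for p = x expands
   tau (x^n ⊗ a) over words in sigma and delta, and the hypothesis leaves only
   tau (x^n ⊗ a) = sigma^n a ⊗ x^n. Hence tau intertwines x^n ⊗ 1 on k[x] ⊗ A
   with sigma^n ⊗ x^n on A ⊗ k[x]; as sigma and tau are bijective, tau maps
   (x^n) ⊗ A onto A ⊗ (x^n), so tau and its inverse both descend. The hexagon
   passes to the quotient, and associativity of the twisted product follows
   from the hexagon. *)
Require Import Defs.
From HB Require Import structures.
From mathcomp Require Import all_boot all_order all_algebra.

Import GRing.Theory.
Local Open Scope ring_scope.
Local Open Scope tensor_scope.

(** * Linear maps and induction on tensor products *)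

Section Tensors.
Variable k : fieldType.

(** Named so that the partial applications carry a linear structure and can be fed to [tmap]. *)
Definition tensr (V W : lmodType k) (v : V) : W -> V ⊗ W := tens v.
Definition tensl (V W : lmodType k) (w : W) : V -> V ⊗ W := tens^~ w.

HB.instance Definition _ (V W : lmodType k) (v : V) :=
  GRing.isLinear.Build k W (V ⊗ W) *:%R (@tensr V W v)
    ((tensor_bilinear V W).2 v).
HB.instance Definition _ (V W : lmodType k) (w : W) :=
  GRing.isLinear.Build k V (V ⊗ W) *:%R (@tensl V W w)
    ((tensor_bilinear V W).1 w).

Lemma tensDl (V W : lmodType k) (v v' : V) (w : W) :
  (v + v') ⊗t w = v ⊗t w + v' ⊗t w.
Proof. exact: (linearD (tensl V W w)). Qed.

Lemma tensDr (V W : lmodType k) (v : V) (w w' : W) :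
  v ⊗t (w + w') = v ⊗t w + v ⊗t w'.
Proof. exact: (linearD (tensr V W v)). Qed.

Lemma tens0l (V W : lmodType k) (w : W) : (0 : V) ⊗t w = 0.
Proof. exact: (linear0 (tensl V W w)). Qed.

Lemma tens0r (V W : lmodType k) (v : V) : v ⊗t (0 : W) = 0.
Proof. exact: (linear0 (tensr V W v)). Qed.

(** Every tensor is a finite sum of pure ones, and the empty sum is the pure tensor 0 ⊗ 0. *)
Lemma tensor_ind (V W : lmodType k) (P : V ⊗ W -> Prop) :
  (forall v w, P (v ⊗t w)) -> (forall x y, P x -> P y -> P (x + y)) ->
  forall x, P x.
Proof.
move=> Pt PD x; rewrite -[x]tclassK tclassE.
apply: (big_ind P) => [|//|p _]; last exact: Pt.
by rewrite -(tens0l V W 0); apply: Pt.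
Qed.

(** Extends [tmidE] to the case where [f (x ⊗t y)] is a sum of pure tensors, as happens for a
    twisting map. *)
Lemma tmid_tens (P X Y Z W Q : lmodType k) (f : {linear X ⊗ Y -> Z ⊗ W})
    p x y q :
  tmid P Q f ((p ⊗t x) ⊗t (y ⊗t q))
  = tmap (tensr P Z p) (tensl W Q q) (f (x ⊗t y)).
Proof.
rewrite /tmid /= tassocE tmapE /= tassoc_invE tmapE.
elim/tensor_ind: (f _) => [z w|u v IHu IHv].
  by rewrite tassocE tassoc_invE tmapE.
by rewrite !(tensDl, tensDr, linearD) /= IHu IHv.
Qed.

Lemma linear_inverse (U V : lmodType k) (f : {linear U -> V}) :
  bijective f -> exists2 g : {linear V -> U}, cancel f g & cancel g f.
Proof.
case=> g fK gK; pose gL := GRing.isLinear.Build k V U *:%R g (can2_linear fK gK).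
by exists (HB.pack_for {linear V -> U} g gL).
Qed.

End Tensors.

Arguments tensr {k V W} v w /.
Arguments tensl {k V W} w v /.

(** * One-sided multiplications as linear maps *)

Section Actions.
Variables (k : fieldType) (A : uAlgType k).

Definition lmul (a b : A) : A := a ∙ b.
Definition rmul (b a : A) : A := a ∙ b.

HB.instance Definition _ a :=
  GRing.isLinear.Build k A A *:%R (lmul a) ((@algM_bilinear k A).2 a).
HB.instance Definition _ b :=
  GRing.isLinear.Build k A A *:%R (rmul b) ((@algM_bilinear k A).1 b).

End Actions.

Arguments lmul {k A} a b /.
Arguments rmul {k A} b a /.

(** * Twisting maps and their twisted products *)

Section TwistingMaps.
Variables (k : fieldType) (A B : uAlgType k) (tau : {linear B ⊗ A -> A ⊗ B}).

Local Notation "u ⋆ v" := (twisted_mul tau (u ⊗t v))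
  (at level 40, left associativity).

Lemma twisted_mulE a b a' b' :
  (a ⊗t b) ⋆ (a' ⊗t b') = tmap (lmul a) (rmul b') (tau (b ⊗t a')).
Proof.
rewrite /twisted_mul /= tmid_tens.
elim/tensor_ind: (tau _) => [x y|u v IHu IHv]; last first.
  by rewrite !linearD /= IHu IHv.
by rewrite !tmapE /= !tmulE.
Qed.

Lemma twisted_mulDl u v w : (u + v) ⋆ w = u ⋆ w + v ⋆ w.
Proof. by rewrite tensDl linearD. Qed.

Lemma twisted_mulDr u v w : w ⋆ (u + v) = w ⋆ u + w ⋆ v.
Proof. by rewrite tensDr linearD. Qed.

(** Both sides of the hexagon are linear, so pure tensors suffice. The inner [tau (b' ⊗t a)] need
    not be pure; [tensr b] and [tensl a'] put the outer factors around each of its terms. *)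
Lemma hexagonE :
  (tau \o tmap (tmul B) (tmul A)
     =1 tmap (tmul A) (tmul B) \o tmid A B tau \o tmap tau tau
          \o tmid B A tau)
  <-> forall b b' a a', tau ((b ∙ b') ⊗t (a ∙ a')) =
      twisted_mul tau (tmap tau tau (tmap (tensr b) (tensl a') (tau (b' ⊗t a)))).
Proof.
split=> [H b b' a a'|H z].
  by have := H ((b ⊗t b') ⊗t (a ⊗t a')); rewrite /= tmid_tens tmapE /= !tmulE.
elim/tensor_ind: z => [x y|x y]; last by rewrite !linearD /= => -> ->.
elim/tensor_ind: x => [b b'|x x' IHx IHx']; last first.
  by move: IHx IHx'; rewrite /= tensDl !linearD /= => -> ->.
elim/tensor_ind: y => [a a'|x x' IHx IHx']; last first.
  by move: IHx IHx'; rewrite /= tensDr !linearD /= => -> ->.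
by rewrite /= tmid_tens tmapE /= !tmulE H.
Qed.

Hypothesis tw : twisting_map tau.

Let tau1 a : tau (alg1 ⊗t a) = a ⊗t alg1. Proof. by case: tw. Qed.
Let tau_1 b : tau (b ⊗t alg1) = alg1 ⊗t b. Proof. by case: tw. Qed.
Let hexagon b b' a a' : tau ((b ∙ b') ⊗t (a ∙ a')) =
  twisted_mul tau (tmap tau tau (tmap (tensr b) (tensl a') (tau (b' ⊗t a)))).
Proof. by case: tw => _ _ _ /hexagonE. Qed.

(** The hexagon with second algebra factor 1, where one of the two outer copies of [tau] becomes a
    swap. *)
Lemma twisting_mull b b' a :
  tau ((b ∙ b') ⊗t a) = (alg1 ⊗t b) ⋆ tau (b' ⊗t a).
Proof.
rewrite -[a in LHS]algM1 hexagon.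
elim/tensor_ind: (tau _) => [x y|u v IHu IHv].
  rewrite tmapE /= tmapE tau_1 twisted_mulE.
  elim/tensor_ind: (tau _) => [x' y'|u v IHu IHv].
    by rewrite twisted_mulE tau_1 !tmapE /= alg1M algM1.
  by rewrite twisted_mulDl IHu IHv !linearD /=.
by rewrite !linearD /= twisted_mulDr IHu IHv.
Qed.

Lemma twisting_mulr b a a' :
  tau (b ⊗t (a ∙ a')) = tau (b ⊗t a) ⋆ (a' ⊗t alg1).
Proof.
rewrite -[b in LHS]alg1M hexagon.
elim/tensor_ind: (tau _) => [x y|u v IHu IHv].
  rewrite tmapE /= tmapE tau1 twisted_mulE.
  elim/tensor_ind: (tau _) => [x' y'|u v IHu IHv].
    by rewrite twisted_mulE tau1 !tmapE /= alg1M algM1.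
  by rewrite twisted_mulDr IHu IHv !linearD /=.
by rewrite !linearD /= twisted_mulDl IHu IHv.
Qed.

Lemma twisted_mul_actl a u v : tmap (lmul a) (tid B) u ⋆ v
  = tmap (lmul a) (tid B) (u ⋆ v).
Proof.
elim/tensor_ind: u => [x y|x y IHx IHy]; last first.
  by rewrite linearD !twisted_mulDl linearD /= IHx IHy.
elim/tensor_ind: v => [x' y'|z z' IHx IHy]; last first.
  by rewrite !twisted_mulDr linearD /= IHx IHy.
rewrite tmapE !twisted_mulE /=.
elim/tensor_ind: (tau _) => [z z'|z z' IHx IHy]; last first.
  by rewrite !linearD /= IHx IHy.
by rewrite !tmapE /= algMA.
Qed.

Lemma twisted_mul_actr b u v : u ⋆ tmap (tid A) (rmul b) v
  = tmap (tid A) (rmul b) (u ⋆ v).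
Proof.
elim/tensor_ind: u => [x y|x y IHx IHy]; last first.
  by rewrite !twisted_mulDl linearD /= IHx IHy.
elim/tensor_ind: v => [x' y'|z z' IHx IHy]; last first.
  by rewrite linearD !twisted_mulDr linearD /= IHx IHy.
rewrite tmapE !twisted_mulE /=.
elim/tensor_ind: (tau _) => [z z'|z z' IHx IHy]; last first.
  by rewrite !linearD /= IHx IHy.
by rewrite !tmapE /= algMA.
Qed.

Lemma twisted_mul_purel a b v :
  (a ⊗t b) ⋆ v = tmap (lmul a) (tid B) ((alg1 ⊗t b) ⋆ v).
Proof. by rewrite -twisted_mul_actl tmapE /= algM1. Qed.

Lemma twisted_mul_purer u a b :
  u ⋆ (a ⊗t b) = tmap (tid A) (rmul b) (u ⋆ (a ⊗t alg1)).
Proof. by rewrite -twisted_mul_actr tmapE /= alg1M. Qed.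

Lemma twisted_mul_tau b a : (alg1 ⊗t b) ⋆ (a ⊗t alg1) = tau (b ⊗t a).
Proof.
rewrite twisted_mulE.
elim/tensor_ind: (tau _) => [x y|x y IHx IHy]; last by rewrite linearD /= IHx IHy.
by rewrite tmapE /= alg1M algM1.
Qed.

Lemma twisted_mul_pure a b : (a ⊗t alg1) ⋆ (alg1 ⊗t b) = a ⊗t b.
Proof. by rewrite twisted_mulE tau1 tmapE /= algM1 alg1M. Qed.

Lemma twisted_mul1l : left_id (alg1 ⊗t alg1) (fun u v => u ⋆ v).
Proof.
elim/tensor_ind=> [a b|u v IHu IHv]; last by rewrite twisted_mulDr IHu IHv.
by rewrite twisted_mulE tau1 tmapE /= !alg1M.
Qed.

Lemma twisted_mulr1 : right_id (alg1 ⊗t alg1) (fun u v => u ⋆ v).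
Proof.
elim/tensor_ind=> [a b|u v IHu IHv]; last by rewrite twisted_mulDl IHu IHv.
by rewrite twisted_mulE tau_1 tmapE /= !algM1.
Qed.

(** This is associativity for the factors 1 ⊗ b, a' ⊗ b' and a'' ⊗ 1. Both bracketings equal tau (b
    ⊗ a') ⋆ tau (b' ⊗ a''), one by [twisting_mulr], the other by [twisting_mull]. *)
Lemma twisted_mul_exchange b a' b' a'' :
  (alg1 ⊗t b) ⋆ tmap (lmul a') (tid B) (tau (b' ⊗t a''))
  = tmap (tid A) (rmul b') (tau (b ⊗t a')) ⋆ (a'' ⊗t alg1).
Proof.
transitivity (tau (b ⊗t a') ⋆ tau (b' ⊗t a'')).
  elim/tensor_ind: (tau (b' ⊗t a'')) => [x y|u v IHu IHv]; last first.
    by rewrite linearD /= !twisted_mulDr IHu IHv.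
  rewrite tmapE /= twisted_mul_purer twisted_mul_tau twisting_mulr.
  by rewrite -twisted_mul_purer.
elim/tensor_ind: (tau (b ⊗t a')) => [x y|u v IHu IHv]; last first.
  by rewrite linearD /= !twisted_mulDl IHu IHv.
rewrite tmapE /= twisted_mul_purel -twisting_mull -twisted_mul_tau.
by rewrite -twisted_mul_purel.
Qed.

(** On pure tensors the leftmost [A]-factor and the rightmost [B]-factor pull out of both
    bracketings, which leaves [twisted_mul_exchange]. *)
Lemma twisted_mulA : associative (fun u v => u ⋆ v).
Proof.
elim/tensor_ind=> [a b|u u' IHu IHu' v w]; last first.
  by rewrite !twisted_mulDl IHu IHu'.
elim/tensor_ind=> [a' b'|v v' IHv IHv' w]; last first.
  by rewrite twisted_mulDl !twisted_mulDr twisted_mulDl IHv IHv'.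
elim/tensor_ind=> [a'' b''|w w' IHw IHw']; last first.
  by rewrite !twisted_mulDr IHw IHw'.
have splitE x y z : tmap (lmul x) (rmul y) z
  = tmap (lmul x) (tid B) (tmap (tid A) (rmul y) z).
  elim/tensor_ind: z => [p q|u v IHu IHv]; last by rewrite !linearD /= IHu IHv.
  by rewrite !tmapE.
have splitC x y z : tmap (lmul x) (tid B) (tmap (tid A) (rmul y) z)
  = tmap (tid A) (rmul y) (tmap (lmul x) (tid B) z).
  elim/tensor_ind: z => [p q|u v IHu IHv]; last by rewrite !linearD /= IHu IHv.
  by rewrite !tmapE.
rewrite !twisted_mulE !splitE.
rewrite (twisted_mul_purel a) (twisted_mul_purer _ a'').
rewrite splitC twisted_mul_actr twisted_mul_actl twisted_mul_exchange.
by rewrite splitC.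
Qed.

Lemma twisted_ore_multiplication (sigma delta : {linear A -> A}) (x : B) :
  (forall a, tau (x ⊗t a) = sigma a ⊗t x + delta a ⊗t alg1) ->
  ore_multiplication sigma delta x (twisted_mul tau).
Proof.
move=> tau_x; split.
- exact: twisted_mulA.
- by split; [exact: twisted_mul1l | exact: twisted_mulr1].
- by split=> x1 x2; rewrite [LHS]twisted_mulE ?tau1 ?tau_1 tmapE /= ?algM1 ?alg1M.
- exact: twisted_mul_pure.
- by move=> a; rewrite [LHS]twisted_mul_tau.
Qed.

End TwistingMaps.

(** * Passing a twisting map to a quotient algebra *)

Section Descent.
Variables (k : fieldType) (A R R' : uAlgType k).
Variables (pi : {linear R -> R'}) (s : {linear R' -> R}).
Variables (tau : {linear R ⊗ A -> A ⊗ R}) (tau' : {linear R' ⊗ A -> A ⊗ R'}).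
Hypotheses (sK : cancel s pi) (pi1 : pi alg1 = alg1).
Hypothesis piM : {morph pi : p q / p ∙ q}.
Hypothesis tauE : forall z, tau' (tmap pi (tid A) z) = tmap (tid A) pi (tau z).

Let tauE_pure p a : tau' (pi p ⊗t a) = tmap (tid A) pi (tau (p ⊗t a)).
Proof. by rewrite -tauE tmapE. Qed.

Lemma descent_twisted_mul u v :
  twisted_mul tau' (tmap (tid A) pi u ⊗t tmap (tid A) pi v)
  = tmap (tid A) pi (twisted_mul tau (u ⊗t v)).
Proof.
elim/tensor_ind: u => [a p|u u' IHu IHu']; last first.
  by rewrite linearD !twisted_mulDl IHu IHu' linearD.
elim/tensor_ind: v => [b q|v v' IHv IHv']; last first.
  by rewrite linearD !twisted_mulDr IHv IHv' linearD.
rewrite !tmapE !twisted_mulE tauE_pure.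
elim/tensor_ind: (tau _) => [x y|u v IHu IHv]; last first.
  by rewrite !linearD /= IHu IHv.
by rewrite !tmapE /= piM.
Qed.

(** The section [s] lifts elements of [R'] to [R], where the identities hold; [tauE] carries them
    back along [pi]. Only bijectivity has to be supplied separately. *)
Lemma descent_twisting_map :
  twisting_map tau -> bijective tau' -> twisting_map tau'.
Proof.
case=> _ tau1 tau_1 /hexagonE hexagon bij; split=> // [a|b|].
- by rewrite -pi1 tauE_pure tau1 tmapE.
- by rewrite -[b]sK tauE_pure tau_1 tmapE.
apply/hexagonE => p p' a a'; rewrite -[p]sK -[p']sK -piM tauE_pure hexagon.
rewrite tauE_pure.
elim/tensor_ind: (tau _) => [x y|u v IHu IHv]; last first.
  by rewrite !linearD /= IHu IHv.
by rewrite !tmapE /= !tauE_pure descent_twisted_mul.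
Qed.

End Descent.

(** * Expansion of tau (x^m ⊗ a) over words in sigma and delta *)

Section Words.
Variables (k : fieldType) (A : uAlgType k) (sigma delta : {linear A -> A}).

Lemma sum_tuple_cons (V : nmodType) m (F : seq bool -> V) :
  \sum_(w : m.+1.-tuple bool) F w
  = \sum_(w : m.-tuple bool) F (true :: w)
    + \sum_(w : m.-tuple bool) F (false :: w).
Proof.
rewrite (reindex (fun p : bool * m.-tuple bool => [tuple of p.1 :: p.2])) /=.
  by rewrite -(pair_bigA _ (fun b (w : m.-tuple bool) => F (b :: w))) big_bool.
exists (fun w => (thead w, behead_tuple w)) => [[b w] _|w _] /=.
  by congr (_, _); apply: val_inj.
by rewrite [RHS]tuple_eta; apply: val_inj.
Qed.

Lemma word_comp_true m a : word_comp sigma delta (nseq m true) a = iter m sigma a.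
Proof. by elim: m => //= m ->. Qed.

Variable tau : {linear {poly k} ⊗ A -> A ⊗ {poly k}}.
Hypothesis tau_ore : ore_twisting_map sigma delta tau.

(** Left multiplication by 1 ⊗ x prepends either sigma, raising the exponent of x by one, or delta,
    leaving it unchanged. *)
Lemma ore_tau_Xn m a : tau ('X^m ⊗t a) =
  \sum_(w : m.-tuple bool)
    word_comp sigma delta w a ⊗t 'X^(count_mem true w).
Proof.
case: tau_ore => tw tauX; elim: m => [|m IHm].
  case: tw => _ tau1 _ _.
  rewrite (big_pred1 [tuple]) /=; last by move=> w; apply/esym/eqP/tuple0.
  by rewrite expr0 tau1.
rewrite (sum_tuple_cons _ _
  (fun w => word_comp sigma delta w a ⊗t 'X^(count_mem true w))).
rewrite exprS twisting_mull // IHm -big_split /=.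
pose f : {linear A ⊗ {poly k} -> A ⊗ {poly k}} :=
  twisted_mul tau \o tensr (alg1 ⊗t 'X).
rewrite -[LHS]/(f _) linear_sum; apply: eq_bigr => w _.
by rewrite /f /= twisted_mulE tauX linearD /= !tmapE /= !alg1M add1n exprS.
Qed.

Lemma ore_tau_Xn_top n :
  (forall i j : nat, (0 <= i <= n - 1)%N -> (1 <= j <= n)%N ->
       (i + j)%N = n -> forall a : A, s_words i j sigma delta a = 0) ->
  forall a, tau ('X^n ⊗t a) = iter n sigma a ⊗t 'X^n.
Proof.
move=> s_eq0 a; rewrite ore_tau_Xn.
have countP (w : n.-tuple bool) : (count_mem true w < n.+1)%N.
  by rewrite ltnS -[leqRHS](size_tuple w) count_size.
(* Words are grouped by their number i of letters sigma; the class i = n, containing only sigma^n,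
   is split off. *)
rewrite (partition_big (fun w => Ordinal (countP w)) predT) //= big_ord_recr /=.
rewrite big1 ?add0r => [|i _].
  rewrite (big_pred1 (nseq_tuple n true)) => [/=|w].
    by rewrite word_comp_true count_nseq mul1n.
  rewrite -val_eqE -[RHS]val_eqE /=; have := size_tuple w.
  by move: (tval w) => v <-; rewrite -all_count; apply/all_pred1P/eqP.
(* [s_words] sums over tuples of length i + j; a variable [m] lets the equation be substituted in
   the tuple type. *)
have words (m j : nat) : (i + j)%N = m ->
  \sum_(w : m.-tuple bool | count_mem true w == i)
    word_comp sigma delta w a = s_words i j sigma delta a by move=> <-.
transitivity (tensl ('X^i : {poly k}) (s_words i (n - i) sigma delta a)).
  rewrite -(words n) ?subnKC 1?ltnW // linear_sum.
  by apply: eq_bigr => w; rewrite -val_eqE /= => /eqP ->.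
have lt_in := ltn_ord i; have le_in := ltnW lt_in.
rewrite s_eq0 ?linear0 ?subnKC ?subn_gt0 ?lt_in ?leq_subr //.
by rewrite leq_subRL ?add1n // (leq_ltn_trans _ lt_in).
Qed.

End Words.

(** * Remainders modulo x^n and the descent of tau *)

Lemma in_qpoly_val (k : fieldType) (h : {poly k}) :
  cancel (@polyn k (size (mk_monic h)).-1) (in_qpoly h).
Proof.
move=> q; apply: val_inj; apply: in_qpoly_small; exact: size_mk_monic.
Qed.

(** Euclidean division: the hypotheses make [mk_monic h] equal to [h]. *)
Lemma in_qpoly_divE (k : fieldType) (h p : {poly k}) :
  h \is monic -> (1 < size h)%N ->
  p = (in_qpoly h p : {poly k}) + h * (p %/ h).
Proof.
move=> h_mon h_gt1.
rewrite {1}[p](divp_eq p h) addrC mulrC; congr (_ + _) => /=.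
by rewrite /mk_monic h_gt1 h_mon Pdiv.IdomainMonic.modpE.
Qed.

Theorem theorem2p7 (k : fieldType) (n : nat) (n_ge2 : (2 <= n)%N)
    (A : uAlgType k) (sigma delta : {linear A -> A})
    (sigma_aut : algebra_automorphism sigma)
    (delta_der : left_derivation sigma delta)
    (tau : {linear {poly k} ⊗ A -> A ⊗ {poly k}})
    (tau_ore : ore_twisting_map sigma delta tau)
    (s_eq0 : forall i j : nat, (0 <= i <= n - 1)%N -> (1 <= j <= n)%N ->
       (i + j)%N = n -> forall a : A, s_words i j sigma delta a = 0) :
  exists tau_bar : {linear {poly %/ 'X^n : {poly k}} ⊗ A ->
                            A ⊗ {poly %/ 'X^n : {poly k}}},
    [/\ tau_bar \o tmap (in_qpoly ('X^n : {poly k})) (tid A)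
          =1 tmap (tid A) (in_qpoly ('X^n : {poly k})) \o tau,
        twisting_map tau_bar
      & ore_multiplication sigma delta (in_qpoly 'X^n 'X) (twisted_mul tau_bar)].
Proof.
have tau_Xn := ore_tau_Xn_top _ _ _ _ _ tau_ore _ s_eq0.
have [tw tau_X] := tau_ore.
have [tau_bij tau1 tau_1 _] := tw.
have [_ _ sigma_bij] := sigma_aut.
have [tauV tauK tauVK] := linear_inverse _ _ _ _ tau_bij.
pose R := {poly %/ 'X^n : {poly k}}.
pose pi : {linear {poly k} -> R} := in_qpoly 'X^n.
pose s : {linear R -> {poly k}} := @polyn _ _.
have piK : cancel s pi by exact: in_qpoly_val.
have piXn q : pi ('X^n * q) = 0.
  (* [mk_monic 'X^n] is ['X^n.-1.+1], which is ['X^n] since n is positive. *)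
  apply: val_inj; rewrite /= mk_monic_Xn prednK ?(ltnW n_ge2) //.
  by rewrite mulrC Pdiv.RingMonic.rmodp_mull ?monicXn.
have pi_div p : exists q, p = s (pi p) + 'X^n * q.
  exists (p %/ 'X^n); apply: in_qpoly_divE.
    exact: monicXn.
  by rewrite size_polyXn ltnS ltnW.
have tau_XnM z : tau (tmap (lmul 'X^n) (tid A) z) =
    twisted_mul tau ((alg1 ⊗t 'X^n) ⊗t tau z).
  elim/tensor_ind: z => [q a|u v IHu IHv].
    by rewrite tmapE /= twisting_mull.
  by rewrite !linearD /= IHu IHv twisted_mulDr.
have mulXn a q : twisted_mul tau ((alg1 ⊗t 'X^n) ⊗t (a ⊗t q)) =
    iter n sigma a ⊗t ('X^n * q).
  by rewrite twisted_mulE tau_Xn tmapE /= alg1M.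
pose P := tmap pi (tid A); pose Q := tmap (tid A) pi.
have Qker p a : Q (tau (('X^n * p) ⊗t a)) = 0.
  have -> : ('X^n * p) ⊗t a = tmap (lmul 'X^n) (tid A) (p ⊗t a).
    by rewrite tmapE.
  rewrite tau_XnM /Q; elim/tensor_ind: (tau _) => [b q|u v IHu IHv].
    by rewrite mulXn tmapE piXn tens0r.
  by rewrite twisted_mulDr linearD /= IHu IHv addr0.
have Pker p a : P (tauV (a ⊗t ('X^n * p))) = 0.
  (* Write a = sigma^n a0. Then a ⊗ x^n p = (1 ⊗ x^n) ⋆ (a0 ⊗ p) is the image under tau of x^n
     acting on tauV (a0 ⊗ p), which [P] kills. *)
  have [sigmaV _ sigmaVK] := sigma_bij.
  have iterK : cancel (iter n sigmaV) (iter n sigma).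
    by elim: (n) => // m IHm x; rewrite iterSr /= sigmaVK IHm.
  rewrite -(iterK a) -mulXn -[_ ⊗t p]tauVK -tau_XnM tauK /P.
  elim/tensor_ind: (tauV _) => [b q|u v IHu IHv].
    by rewrite !tmapE /= piXn tens0l.
  by rewrite !linearD /= IHu IHv addr0.
(* Both induced maps are computed on remainders through [s]; [Qker] and [Pker] then show that the
   choice of representative is immaterial. *)
pose tau_bar : {linear R ⊗ A -> A ⊗ R} :=
  tmap (tid A) pi \o tau \o tmap s (tid A).
pose tauV_bar : {linear A ⊗ R -> R ⊗ A} :=
  tmap pi (tid A) \o tauV \o tmap (tid A) s.
have tau_barE z : tau_bar (P z) = Q (tau z).
  rewrite /tau_bar /P /Q /=.
  elim/tensor_ind: z => [p a|u v IHu IHv]; last by rewrite !linearD /= IHu IHv.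
  have [q {2}->] := pi_div p.
  by rewrite /= !tmapE tensDl !linearD /= [X in _ + X]Qker addr0.
have tauV_barE z : tauV_bar (Q z) = P (tauV z).
  rewrite /tauV_bar /P /Q /=.
  elim/tensor_ind: z => [a p|u v IHu IHv]; last by rewrite !linearD /= IHu IHv.
  have [q {2}->] := pi_div p.
  by rewrite /= !tmapE tensDr !linearD /= [X in _ + X]Pker addr0.
have PK z : P (tmap s (tid A) z) = z.
  rewrite /P; elim/tensor_ind: z => [p a|u v IHu IHv].
    by rewrite !tmapE piK.
  by rewrite !linearD /= IHu IHv.
have QK z : Q (tmap (tid A) s z) = z.
  rewrite /Q; elim/tensor_ind: z => [p a|u v IHu IHv].
    by rewrite !tmapE piK.
  by rewrite !linearD /= IHu IHv.
have tau_bar_bij : bijective tau_bar.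
  (* [P] and [Q] are surjective, so the inverse laws follow from those of tau and tauV. *)
  exists tauV_bar => z.
    by rewrite -[z]PK tau_barE tauV_barE tauK.
  by rewrite -[z]QK tauV_barE tau_barE tauVK.
have tw_bar : twisting_map tau_bar.
  apply: (descent_twisting_map _ _ _ _ pi s tau) => //.
  - exact: in_qpoly1.
  - exact: in_qpolyM.
exists tau_bar; split=> //.
apply: twisted_ore_multiplication => // a.
rewrite -/(pi 'X).
have -> : pi 'X ⊗t a = P ('X ⊗t a) by rewrite /P tmapE.
rewrite tau_barE tau_X /Q linearD /= !tmapE /=.
by congr (_ + _ ⊗t _); apply: in_qpoly1.
Qed.
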